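(* Let $\beta,\gamma\in[0,2)$ with $\beta+\gamma<2$, let $n\ge 0$ be an integer, and let $$T_n^{\beta,\gamma}(x)=\cos\left(\frac{2n}{2-\beta-\gamma}\left(\arccos x-\frac{\gamma\pi}{2}\right)\right),\quad x\in[-1,1].$$ Then $y=T_n^{\beta,\gamma}$ is a non-trivial (i.e. not identically zero) solution, on $\Omega_{\beta,\gamma}=[-\cos(\beta\pi/2),\cos(\gamma\pi/2)]\subseteq[-1,1]$, of the Sturm-Liouville boundary problem $$\frac{\mathrm d}{\mathrm dx}\left(\sqrt{1-x^2}\,\frac{\mathrm dy}{\mathrm dx}\right)+\frac{4n^2}{(2-\beta-\gamma)^2}\,\frac{1}{\sqrt{1-x^2}}\,y=0$$ with separated boundary conditions $$a_1\,y(-\cos(\beta\pi/2))+a_2\,y'(-\cos(\beta\pi/2))=0,\qquad b_1\,y(\cos(\gamma\pi/2))+b_2\,y'(\cos(\gamma\pi/2))=0,$$ for some real constants $a_1,a_2,b_1,b_2$ with $a_1^2+a_2^2>0$ and $b_1^2+b_2^2>0$.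
   Context: The differential equation is understood at the interior points of $\Omega_{\beta,\gamma}$. The boundary conditions are understood in the limit sense, i.e. the values of $y$ and $y'$ at an endpoint are the one-sided limits of $y(x)$ and $y'(x)$ as $x$ tends to that endpoint from inside $\Omega_{\beta,\gamma}$ (this matters when an endpoint equals $\pm1$, where the coefficients are singular). *)

(* Defs.v *)
From Stdlib Require Import Reals.
From Coquelicot Require Import Coquelicot.
Open Scope R_scope.

Definition T_fun (beta gamma : R) (n : nat) (x : R) : R :=
  cos (2 * INR n / (2 - beta - gamma) * (acos x - gamma * PI / 2)).

Definition Omega_left (beta : R) : R := - cos (beta * PI / 2).
Definition Omega_right (gamma : R) : R := cos (gamma * PI / 2).
Definition in_Omega (beta gamma x : R) : Prop :=
  Omega_left beta <= x <= Omega_right gamma.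

(* [(p y')' + q y = 0] on the open interval ]l, r[.  [Derive] is total, so the
   differentiability of [y] and of [p y'] has to be required separately. *)
Definition solves_SL_ode (p q : R -> R) (l r : R) (y : R -> R) : Prop :=
  forall x, l < x < r ->
    ex_derive y x /\
    ex_derive (fun t => p t * Derive y t) x /\
    Derive (fun t => p t * Derive y t) x + q x * y x = 0.

(* [c1 y(e) + c2 y'(e) = 0], where [y(e)] and [y'(e)] denote the limits, required
   to exist and to be finite, along [F], which is [at_right e] at a left endpoint
   and [at_left e] at a right endpoint. *)
Definition SL_boundary_condition (F : (R -> Prop) -> Prop) (c1 c2 : R)
    (y : R -> R) : Prop :=
  exists y0 y1 : R,
    filterlim y F (locally y0) /\
    filterlim (Derive y) F (locally y1) /\
    c1 * y0 + c2 * y1 = 0.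

Definition SL_boundary_solution (p q : R -> R) (l r a1 a2 b1 b2 : R)
    (y : R -> R) : Prop :=
  solves_SL_ode p q l r y /\
  SL_boundary_condition (at_right l) a1 a2 y /\
  SL_boundary_condition (at_left r) b1 b2 y.

(* Main.v *)
Require Import Defs.
From Stdlib Require Import Reals Lra.
From Coquelicot Require Import Coquelicot.
Open Scope R_scope.

(** Put [x = cos t], [t = acos x], and [k = 2 n / (2 - beta - gamma)].  As
    [acos' x = - 1 / sqrt (1 - x ^ 2)], the function
    [y x = cos (k * (acos x - c))] satisfies
    [sqrt (1 - x ^ 2) * y' x = k * sin (k * (acos x - c))], and differentiating
    once more gives [- k ^ 2 * y x / sqrt (1 - x ^ 2)], which is the equation.

    The endpoints of Omega are [cos c] and [cos d], with [c = gamma * PI / 2] and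
    [d = PI - beta * PI / 2], so that [0 <= c < d <= PI].  Since
    [k * (d - c) = n * PI], the phase [k * (t - c)] is a multiple of [PI] at both
    ends: there [y] tends to [1] or [-1], and the numerator of
    [y' = k * sin (k * (t - c)) / sin t] vanishes.  Zeros of [sin] being simple,
    this quotient has a finite limit even where [sin t] vanishes too, that is,
    when the endpoint is [1] or [-1] ([ex_lim_quotient_root]).  Once both limits
    [y0 <> 0] and [y1] exist, the coefficients [- y1] and [y0] give the boundary
    condition. *)

(** * The cosine of a multiple of the arccosine *)

Lemma is_derive_acos (x : R) :
  -1 < x < 1 -> is_derive acos x (- / sqrt (1 - x ^ 2)).
Proof.
  intros Hx.
  replace (- / sqrt (1 - x ^ 2)) with (- 1 / sqrt (1 - x²)).
  - rewrite <- (derive_pt_acos x Hx), Derive_Reals.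
    apply Derive_correct, ex_derive_Reals_1, derivable_pt_acos, Hx.
  - replace (1 - x²) with (1 - x ^ 2) by (unfold Rsqr; ring).
    unfold Rdiv. ring.
Qed.

Lemma sqrt_1_minus_sqr_pos (x : R) : -1 < x < 1 -> 0 < sqrt (1 - x ^ 2).
Proof. intros Hx. apply sqrt_lt_R0. nra. Qed.

Lemma is_derive_cos_acos (k c x : R) :
  -1 < x < 1 ->
  is_derive (fun x => cos (k * (acos x - c))) x
    (k * sin (k * (acos x - c)) / sqrt (1 - x ^ 2)).
Proof.
  intros Hx.
  pose proof (is_derive_acos x Hx) as Ha.
  assert (HD : Derive (fun t : R => acos t) x = - / sqrt (1 - x ^ 2))
    by exact (is_derive_unique _ _ _ Ha).
  pose proof (sqrt_1_minus_sqr_pos x Hx) as Hs.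
  auto_derive.
  - now exists (- / sqrt (1 - x ^ 2)).
  - rewrite HD. unfold Rminus in *. field. lra.
Qed.

Lemma Derive_cos_acos (k c x : R) :
  -1 < x < 1 ->
  Derive (fun t : R => cos (k * (acos t - c))) x
  = k * sin (k * (acos x - c)) / sqrt (1 - x ^ 2).
Proof. intros Hx. now apply is_derive_unique, is_derive_cos_acos. Qed.

Lemma is_derive_sin_acos (k c x : R) :
  -1 < x < 1 ->
  is_derive (fun x => k * sin (k * (acos x - c))) x
    (- (k ^ 2 * (1 / sqrt (1 - x ^ 2)) * cos (k * (acos x - c)))).
Proof.
  intros Hx.
  pose proof (is_derive_acos x Hx) as Ha.
  assert (HD : Derive (fun t : R => acos t) x = - / sqrt (1 - x ^ 2))
    by exact (is_derive_unique _ _ _ Ha).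
  pose proof (sqrt_1_minus_sqr_pos x Hx) as Hs.
  auto_derive.
  - now exists (- / sqrt (1 - x ^ 2)).
  - rewrite HD. unfold Rminus in *. field. lra.
Qed.

Lemma locally_between (l r x : R) :
  l < x < r -> locally x (fun t => l < t < r).
Proof.
  intros [Hl Hr].
  apply filter_and; [now apply (open_gt l) | now apply (open_lt r)].
Qed.

Lemma solves_SL_ode_cos_acos (q : R -> R) (k c l r : R) :
  -1 <= l -> r <= 1 ->
  (forall x, q x = k ^ 2 * (1 / sqrt (1 - x ^ 2))) ->
  solves_SL_ode (fun x => sqrt (1 - x ^ 2)) q l r
    (fun x => cos (k * (acos x - c))).
Proof.
  intros Hl Hr Hq x Hx.
  assert (Hx1 : -1 < x < 1) by lra.
  assert (Hpy : is_derive (fun t => sqrt (1 - t ^ 2) *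
                   Derive (fun x => cos (k * (acos x - c))) t) x
                 (- (k ^ 2 * (1 / sqrt (1 - x ^ 2)) * cos (k * (acos x - c))))).
  { apply is_derive_ext_loc with (2 := is_derive_sin_acos k c x Hx1).
    apply filter_imp with (2 := locally_between _ _ _ Hx1).
    intros t Ht.
    rewrite Derive_cos_acos by exact Ht.
    pose proof (sqrt_1_minus_sqr_pos t Ht). simpl. field. simpl in *. lra. }
  split; [| split].
  - eexists. exact (is_derive_cos_acos k c x Hx1).
  - eexists. exact Hpy.
  - apply is_derive_unique in Hpy. simpl in Hpy |- *.
    rewrite Hpy, Hq. simpl. ring.
Qed.

(** * Limits at the endpoints *)

(** One-sided continuity of the arccosine from inside [-1, 1].  It covers the
    points [1] and [-1] ([c = 0] here, [d = PI] below), where [acos] is not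
    differentiable. *)
Lemma filterlim_acos_at_left (c : R) :
  0 <= c < PI -> filterlim acos (at_left (cos c)) (at_right c).
Proof.
  intros Hc P [eps HP].
  set (u := Rmin (c + eps) PI).
  assert (Hu : c < u <= PI /\ u <= c + eps).
  { pose proof (cond_pos eps). unfold u.
    split; [split |]; [apply Rmin_glb_lt; lra | apply Rmin_r | apply Rmin_l]. }
  assert (Hd : 0 < cos c - cos u).
  { apply Rlt_0_minus. apply cos_decreasing_1; lra. }
  exists (mkposreal _ Hd). simpl. intros x Hx Hxc.
  apply Rabs_def2 in Hx. unfold minus, plus, opp in Hx. simpl in Hx.
  pose proof (COS_bound c). pose proof (COS_bound u).
  pose proof (acos_bound x) as Hb.
  assert (Hcx : cos (acos x) = x) by (apply cos_acos; lra).
  assert (c < acos x) by (apply cos_decreasing_0; lra).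
  assert (acos x < u) by (apply cos_decreasing_0; lra).
  apply HP; [| assumption].
  apply Rabs_def1; unfold minus, plus, opp; simpl; lra.
Qed.

Lemma filterlim_acos_at_right (d : R) :
  0 < d <= PI -> filterlim acos (at_right (cos d)) (at_left d).
Proof.
  intros Hd P [eps HP].
  set (u := Rmax (d - eps) 0).
  assert (Hu : 0 <= u < d /\ d - eps <= u).
  { pose proof (cond_pos eps). unfold u.
    split; [split |]; [apply Rmax_r | apply Rmax_lub_lt; lra | apply Rmax_l]. }
  assert (He : 0 < cos u - cos d).
  { apply Rlt_0_minus. apply cos_decreasing_1; lra. }
  exists (mkposreal _ He). simpl. intros x Hx Hxd.
  apply Rabs_def2 in Hx. unfold minus, plus, opp in Hx. simpl in Hx.
  pose proof (COS_bound d). pose proof (COS_bound u).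
  pose proof (acos_bound x) as Hb.
  assert (Hcx : cos (acos x) = x) by (apply cos_acos; lra).
  assert (acos x < d) by (apply cos_decreasing_0; lra).
  assert (u < acos x) by (apply cos_decreasing_0; lra).
  apply HP; [| assumption].
  apply Rabs_def1; unfold minus, plus, opp; simpl; lra.
Qed.

Lemma filterlim_slope (f : R -> R) (a l : R) :
  is_derive f a l ->
  filterlim (fun t => (f t - f a) / (t - a)) (locally' a) (locally l).
Proof.
  intros Hf. apply is_derive_Reals in Hf.
  apply filterlim_locally. intros eps.
  destruct (Hf eps (cond_pos eps)) as [delta Hdelta].
  exists delta. intros t Ht Hta.
  specialize (Hdelta (t - a) ltac:(lra) Ht).
  rewrite Rplus_minus in Hdelta.
  exact Hdelta.
Qed.

Lemma filterlim_derivable (f : R -> R) (a l : R) :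
  is_derive f a l -> filterlim f (locally' a) (locally (f a)).
Proof.
  intros Hf.
  apply (filterlim_filter_le_1 (F := locally a)).
  - apply filter_le_within.
  - apply (ex_derive_continuous f). now exists l.
Qed.

(** A quotient whose numerator vanishes at [a] has a finite limit there as soon
    as the denominator has at most a simple zero. *)
Lemma ex_lim_quotient_root (g h : R -> R) (a g' h' : R) :
  is_derive g a g' -> is_derive h a h' -> g a = 0 -> (h a <> 0 \/ h' <> 0) ->
  exists l, filterlim (fun t => g t / h t) (locally' a) (locally l).
Proof.
  intros Hg Hh Hga Hnz.
  assert (Hdiv : forall (u v : R -> R) (lu lv : R), lv <> 0 ->
            filterlim u (locally' a) (locally lu) ->
            filterlim v (locally' a) (locally lv) ->
            filterlim (fun t => u t / v t) (locally' a) (locally (lu / lv))).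
  { intros u v lu lv Hlv Hu Hv.
    apply (filterlim_comp_2 (G := locally lu) (H := locally (/ lv))
             u (fun t => / v t) Rmult).
    - exact Hu.
    - apply (filterlim_comp _ _ _ v Rinv _ _ _ Hv).
      apply (filterlim_Rbar_inv (Finite lv)). congruence.
    - apply (filterlim_mult lu (/ lv)). }
  destruct (Req_dec (h a) 0) as [Hha | Hha].
  - (* Both vanish at [a]: divide the two slopes. *)
    exists (g' / h').
    apply filterlim_ext_loc with
      (fun t => ((g t - g a) / (t - a)) / ((h t - h a) / (t - a))).
    + exists (mkposreal 1 Rlt_0_1). intros t _ Hta.
      rewrite Hga, Hha, !Rminus_0_r.
      unfold Rdiv. rewrite Rinv_mult, Rinv_inv.
      transitivity (g t * / h t * (/ (t - a) * (t - a))); [ring |].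
      rewrite Rinv_l by lra. ring.
    + apply Hdiv; [tauto | now apply filterlim_slope | now apply filterlim_slope].
  - exists (g a / h a).
    apply Hdiv; [assumption | |]; eapply filterlim_derivable; eassumption.
Qed.

(** The hypotheses on [F] and [G] say that [x = cos t] approaches an endpoint
    along [F], inside [(-1, 1)], while [t = acos x] approaches [e] along [G],
    without reaching it. *)
Lemma SL_boundary_condition_cos_acos (F G : (R -> Prop) -> Prop) (k c e : R) :
  Filter F ->
  filterlim acos F G -> filter_le G (locally' e) ->
  F (fun x => -1 < x < 1) ->
  sin (k * (e - c)) = 0 ->
  exists a1 a2 : R, a1 ^ 2 + a2 ^ 2 > 0 /\
    SL_boundary_condition F a1 a2 (fun x => cos (k * (acos x - c))).
Proof.
  intros HF Hacos HG HFx Hsin.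
  assert (Hy : filterlim (fun x => cos (k * (acos x - c))) F
                 (locally (cos (k * (e - c))))).
  { apply (filterlim_comp _ _ _ acos (fun t => cos (k * (t - c))) F (locally' e)).
    - exact (filterlim_filter_le_2 _ HG Hacos).
    - apply (filterlim_derivable (fun t => cos (k * (t - c))) e
               (- (k * sin (k * (e - c))))).
      auto_derive; [exact I | unfold Rminus; ring]. }
  destruct (ex_lim_quotient_root (fun t => k * sin (k * (t - c))) sin e
              (k * (k * cos (k * (e - c)))) (cos e)) as [y1 Hy1].
  - auto_derive; [exact I | unfold Rminus; ring].
  - apply is_derive_Reals, derivable_pt_lim_sin.
  - rewrite Hsin. ring.
  - destruct (Req_dec (sin e) 0) as [H | H]; [right | now left].
    intros Hc. now apply (cos_sin_0 e).
  - assert (Hy' : filterlim (Derive (fun x => cos (k * (acos x - c)))) F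
                    (locally y1)).
    { apply filterlim_ext_loc with
        (fun x => k * sin (k * (acos x - c)) / sin (acos x)).
      - apply filter_imp with (2 := HFx). intros x Hx.
        rewrite Derive_cos_acos by exact Hx.
        rewrite sin_acos by lra.
        now replace (1 - x²) with (1 - x ^ 2) by (unfold Rsqr; ring).
      - apply (filterlim_comp _ _ _ acos
                 (fun t => k * sin (k * (t - c)) / sin t) F (locally' e)).
        + exact (filterlim_filter_le_2 _ HG Hacos).
        + exact Hy1. }
    exists (- y1), (cos (k * (e - c))). split.
    + assert (cos (k * (e - c)) <> 0)
        by (intros Hc; now apply (cos_sin_0 (k * (e - c)))).
      nra.
    + exists (cos (k * (e - c))), y1. repeat split; [exact Hy | exact Hy' | ring].
Qed.

(** * The boundary problem *)

Lemma Omega_left_cos (beta : R) : Omega_left beta = cos (PI - beta * PI / 2).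
Proof.
  unfold Omega_left. rewrite <- Rtrigo_facts.cos_pi_minus. f_equal.
Qed.

Theorem theorem2 (beta gamma : R) (n : nat)
  (hbeta : 0 <= beta < 2) (hgamma : 0 <= gamma < 2) (hsum : beta + gamma < 2) :
  (forall x : R, in_Omega beta gamma x -> -1 <= x <= 1) /\
  (exists x : R, in_Omega beta gamma x /\ T_fun beta gamma n x <> 0) /\
  (exists a1 a2 b1 b2 : R,
     a1 ^ 2 + a2 ^ 2 > 0 /\
     b1 ^ 2 + b2 ^ 2 > 0 /\
     SL_boundary_solution
       (fun x => sqrt (1 - x ^ 2))
       (fun x => 4 * INR n ^ 2 / (2 - beta - gamma) ^ 2 * (1 / sqrt (1 - x ^ 2)))
       (Omega_left beta) (Omega_right gamma)
       a1 a2 b1 b2 (T_fun beta gamma n)).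
Proof.
  unfold in_Omega, SL_boundary_solution, T_fun.
  rewrite Omega_left_cos. unfold Omega_right.
  set (k := 2 * INR n / (2 - beta - gamma)).
  pose proof PI_RGT_0 as HPI.
  assert (Hphase : k * ((PI - beta * PI / 2) - gamma * PI / 2) = INR n * PI)
    by (unfold k; field; lra).
  set (c := gamma * PI / 2) in *.
  set (d := PI - beta * PI / 2) in *.
  assert (Hcd : 0 <= c < d /\ d <= PI) by (unfold c, d; nra).
  pose proof (COS_bound c) as Hbc. pose proof (COS_bound d) as Hbd.
  assert (Hlt : cos d < cos c) by (apply cos_decreasing_1; lra).
  split; [| split].
  - intros x Hx. lra.
  - exists (cos c). split; [lra |].
    rewrite acos_cos by lra.
    replace (k * (c - c)) with 0 by ring. rewrite cos_0. lra.
  - destruct (SL_boundary_condition_cos_acos (at_right (cos d)) (at_left d) k c d)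
      as (a1 & a2 & Ha & Hleft).
    + apply within_filter, locally_filter.
    + apply filterlim_acos_at_right. lra.
    + intros P [eps HP]. exists eps. intros t Ht Htd. apply HP; [exact Ht | lra].
    + apply filter_imp with (2 := open_lt _ _ Hlt). intros x Hx Hdx. lra.
    + rewrite Hphase, INR_IZR_INZ. apply sin_eq_0_1. now exists (Z.of_nat n).
    + destruct (SL_boundary_condition_cos_acos (at_left (cos c)) (at_right c) k c c)
        as (b1 & b2 & Hb & Hright).
      * apply within_filter, locally_filter.
      * apply filterlim_acos_at_left. lra.
      * intros P [eps HP]. exists eps. intros t Ht Htc. apply HP; [exact Ht | lra].
      * apply filter_imp with (2 := open_gt _ _ Hlt). intros x Hx Hxc. lra.
      * rewrite Rminus_diag, Rmult_0_r. apply sin_0.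
      * exists a1, a2, b1, b2. repeat (split; [assumption |]). split; [| now split].
        apply solves_SL_ode_cos_acos; [lra | lra |].
        intros x. f_equal. unfold k. field. lra.
Qed.
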